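(* Let $(\Omega,\mathcal F)$ be a standard measurable space, $\tau:\Omega\to\Omega$ an $\mathcal F/\mathcal F$-measurable transformation, and $\nu:\mathcal F\to[0,1]$ a convex capacity continuous at $\Omega$. If $\nu$ is strongly invariant, then for each $f\in B(\Omega,\mathcal F)$ there exists $f^\star\in B(\Omega,\mathcal G)$ such that $$\lim_n\frac1n\sum_{k=1}^n f(\tau^{k-1}(\omega))=f^\star(\omega)\qquad\nu\text{-a.s.}$$ and, moreover: 1. For each $P\in\mathcal I$, $f^\star$ is a version of the conditional expectation (under $P$) of $f$ given $\mathcal G$. 2. $\int_\Omega f^\star\,d\nu=\int_\Omega f\,d\nu$. 3. If $\nu$ is ergodic, then $$\nu\left(\left\{\omega\in\Omega:\int_\Omega f\,d\nu\le\lim_n\frac1n\sum_{k=1}^n f(\tau^{k-1}(\omega))\le\int_\Omega f\,d\bar\nu\right\}\right)=1 .$$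
   Context: A capacity is a set function $\nu:\mathcal F\to[0,1]$ with $\nu(\emptyset)=0$, $\nu(\Omega)=1$, and $\nu(A)\le\nu(B)$ whenever $A\subseteq B$. It is convex if $\nu(A\cup B)+\nu(A\cap B)\ge\nu(A)+\nu(B)$ for all $A,B\in\mathcal F$, and continuous at $\Omega$ if $\nu(A_n)\to1$ whenever $A_n\uparrow\Omega$. Its conjugate is $\bar\nu(A)=1-\nu(A^c)$. $\nu$ is strongly invariant if for each $A\in\mathcal F$, $\nu(A\setminus\tau^{-1}(A))=\bar\nu(\tau^{-1}(A)\setminus A)$ and $\nu(\tau^{-1}(A)\setminus A)=\bar\nu(A\setminus\tau^{-1}(A))$. $\mathcal I$ is the set of (countably additive) probability measures $P$ on $\mathcal F$ with $P(A)=P(\tau^{-1}(A))$ for all $A\in\mathcal F$. $\mathcal G=\{A\in\mathcal F:\tau^{-1}(A)=A\}$; $\nu$ is ergodic if $\nu(\mathcal G)=\{\nu(A):A\in\mathcal G\}=\{0,1\}$. For a $\sigma$-algebra $\mathcal H$, $B(\Omega,\mathcal H)$ is the set of bounded $\mathcal H$-measurable functions $\Omega\to\mathbb R$. The Choquet integral of $f\in B(\Omega,\mathcal F)$ with respect to a capacity $\nu$ is $\int_\Omega f\,d\nu=\int_0^\infty\nu(\{f\ge t\})\,dt+\int_{-\infty}^0[\nu(\{f\ge t\})-\nu(\Omega)]\,dt$. A statement holds $\nu$-a.s. if there is $A\in\mathcal F$ with $\nu(A)=1$ such that it holds for all $\omega\in A$. In sets whose description involves a limit, membership of $\omega$ includes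 existence of the limit at $\omega$. A standard measurable space is a standard Borel space. *)

(* Defs.v *)
From HB Require Import structures.
From mathcomp Require Import all_boot all_order all_algebra.
From mathcomp Require Import all_classical all_reals all_analysis.
Import Order.TTheory GRing.Theory Num.Theory.
Import numFieldNormedType.Exports.

Set Implicit Arguments.
Unset Strict Implicit.
Unset Printing Implicit Defensive.

Local Open Scope classical_set_scope.
Local Open Scope ring_scope.

(* The sigma-algebra of [T] is the Borel sigma-algebra of a complete separable
   metric space, the topology being transported along a bijection [phi]. *)
Definition standard_borel (R : realType) d (T : measurableType d) : Prop :=
  exists (M : metricType R) (phi : T -> M),
    [/\ bijective phi,
        forall F : set_system M, ProperFilter F -> cauchy F ->
          exists l : M, F --> l,
        exists2 D : set M, countable D & dense D
      & forall A : set T, measurable A <->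
          exists2 B : set M, <<s @open M >> B & A = phi @^-1` B].

(* Set functions on the sigma-algebra are represented by total functions
   [set T -> R]; only their values on measurable sets are ever constrained. *)
Section capacities.
Context (R : realType) d (T : measurableType d).
Implicit Types (nu : set T -> R) (tau : T -> T) (H : set (set T)) (f : T -> R).

Definition capacity nu : Prop :=
  [/\ forall A, measurable A -> 0 <= nu A <= 1,
      nu set0 = 0,
      nu setT = 1
    & forall A B, measurable A -> measurable B -> A `<=` B -> nu A <= nu B].

Definition convex_capacity nu : Prop :=
  forall A B, measurable A -> measurable B ->
    nu A + nu B <= nu (A `|` B) + nu (A `&` B).

Definition continuous_at_setT nu : Prop :=
  forall A : nat -> set T,
    (forall n, measurable (A n)) -> (forall n, A n `<=` A n.+1) ->
    \bigcup_n A n = setT -> nu (A n) @[n --> \oo] --> (1 : R).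

Definition conjugate nu : set T -> R := fun A => 1 - nu (~` A).

Definition strongly_invariant tau nu : Prop :=
  forall A, measurable A ->
    nu (A `\` tau @^-1` A) = conjugate nu (tau @^-1` A `\` A) /\
    nu (tau @^-1` A `\` A) = conjugate nu (A `\` tau @^-1` A).

Definition invariant_probability tau (P : probability T R) : Prop :=
  forall A, measurable A -> P A = P (tau @^-1` A).

Definition invariant_sets tau : set (set T) :=
  [set A | measurable A /\ tau @^-1` A = A].

Definition ergodic tau nu : Prop :=
  nu @` invariant_sets tau = [set 0; 1].

Definition bounded_measurable H f : Prop :=
  bounded_fun f /\ forall B : set R, measurable B -> H (f @^-1` B).

Definition choquet nu f : R :=
  \int[lebesgue_measure]_(t in `[0, +oo[) nu [set w | t <= f w] +
  \int[lebesgue_measure]_(t in `]-oo, 0]) (nu [set w | t <= f w] - nu setT).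

Definition capacity_as nu (Q : T -> Prop) : Prop :=
  exists A, [/\ measurable A, nu A = 1 & forall w, A w -> Q w].

Definition is_cond_exp (P : probability T R) H f g : Prop :=
  [/\ forall B : set R, measurable B -> H (g @^-1` B),
      P.-integrable setT (EFin \o g)
    & forall A, H A ->
        (\int[P]_(w in A) (g w)%:E = \int[P]_(w in A) (f w)%:E)%E].

(* The index 0 (where the value is 0 by convention) is irrelevant to limits. *)
Definition birkhoff_avg tau f (w : T) : R^nat :=
  fun n => n%:R^-1 * \sum_(1 <= k < n.+1) f (iter k.-1 tau w).

End capacities.

(* Main.v *)
Require Import Defs.
From mathcomp Require Import all_boot all_order all_algebra.
From mathcomp Require Import all_classical all_reals all_analysis.
From mathcomp Require Import measurable_realfun ring lra.
Import Order.TTheory GRing.Theory Num.Theory.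
Import numFieldNormedType.Exports.

(* The Choquet integral I of a convex capacity is monotone, positively
   homogeneous and superadditive.  Strong invariance gives
   I(1_A - 1_A o tau) = 0 for every A, so by superadditivity and uniform
   approximation I(f - f o tau) >= 0 for every bounded f.  This is all that
   Garsia's proof of the maximal ergodic inequality needs: I(g) >= 0 whenever
   some Birkhoff sum of g is positive at each point.  Let f^ be the limsup of
   the Birkhoff averages of f; it is tau-invariant.  Applied to f - f^ + e, the
   inequality gives I(f - f^) >= 0, and likewise I(- f - (- f)^) >= 0.  The sum
   h = f^ + (- f)^ >= 0 is the gap between the limsup and the liminf, and
   I(- h) >= 0 forces nu(h = 0) = 1.  The same two inequalities give
   I(f^) = I(f).  An invariant probability is itself a strongly invariant convex
   capacity, so the averages also converge almost surely under it. *)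

Set Implicit Arguments.
Unset Strict Implicit.
Unset Printing Implicit Defensive.

Local Open Scope classical_set_scope.
Local Open Scope ring_scope.

(** * Riemann sums for the Choquet integral *)

Section riemann_sums.
Context (R : realType).
Notation mu := (@lebesgue_measure R).
Implicit Types (phi : R -> R) (a b delta : R).

Lemma nonincreasing_integrable phi a b : nonincreasing_fun phi ->
  mu.-integrable `[a, b[ (EFin \o phi).
Proof.
move=> phi_ni; apply: measurable_bounded_integrable => //.
- by rewrite /= lebesgue_measure_itv/=; case: ifP => // _; rewrite -EFinB ltry.
- exact: nonincreasing_measurable.
- exists (`|phi a| + `|phi b|); split => [|M hM x /=]; first exact: num_real.
  rewrite in_itv/= => /andP[ax xb]; apply: le_trans (ltW hM).
  have aux y : phi b <= y <= phi a -> `|y| <= `|phi a| + `|phi b|.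
    move=> /andP[yb ya]; have := ler_norm (phi a).
    have := ler_norm (- phi b); rewrite normrN.
    have := normr_ge0 (phi a); have := normr_ge0 (phi b).
    by rewrite ler_norml => *; apply/andP; split; lra.
  by apply: aux; rewrite !phi_ni// ltW.
Qed.

Lemma Rintegral_nonincreasing_bounds phi a b : a <= b -> nonincreasing_fun phi ->
  (b - a) * phi b <= \int[mu]_(t in `[a, b[) phi t <= (b - a) * phi a.
Proof.
move=> ab phi_ni.
have cstE c : \int[mu]_(t in `[a, b[) c = (b - a) * c.
  rewrite Rintegral_cst// mulrC /= lebesgue_measure_itv/= lte_fin.
  move: ab; rewrite le_eqVlt => /predU1P[->|->//].
  by rewrite ltxx subrr.
have icst c : mu.-integrable `[a, b[ (EFin \o cst c).
  by apply: nonincreasing_integrable => x y _ /=.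
rewrite -!cstE; apply/andP; split; apply: le_Rintegral => //=;
  try exact: nonincreasing_integrable; move=> x; rewrite in_itv/= => /andP[ax xb].
  exact/phi_ni/ltW.
exact: phi_ni.
Qed.

(** On each cell a nonincreasing function lies between its right and left end values. Half-open
    cells are disjoint, so the integral is additive over them. *)
Lemma Rintegral_riemann_bounds phi a delta k : 0 <= delta -> nonincreasing_fun phi ->
  delta * (\sum_(1 <= j < k.+1) phi (a + j%:R * delta)) <=
    \int[mu]_(t in `[a, a + k%:R * delta[) phi t <=
  delta * (\sum_(0 <= j < k) phi (a + j%:R * delta)).
Proof.
move=> d0 phi_ni; elim: k => [|k /andP[IH1 IH2]].
  by rewrite mul0r addr0 set_itvco0 Rintegral_set0 !big_geq// mulr0 lexx.
have h1 : a <= a + k%:R * delta by rewrite lerDl mulr_ge0.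
have h2 : a + k%:R * delta <= a + k.+1%:R * delta.
  by rewrite lerD2l ler_wpM2r// ler_nat.
rewrite (@itv_bndbnd_setU _ _ _ (BLeft (a + k%:R * delta))) ?bnd_simp//.
rewrite Rintegral_setU//=; last 2 first.
- rewrite -itv_bndbnd_setU ?bnd_simp//; exact: nonincreasing_integrable.
- apply/disj_setPS => y [/=]; rewrite !in_itv/= => /andP[_ yk] /andP[ky _].
  by move: yk; rewrite ltNge ky.
rewrite big_nat_recr//= [X in _ <= _ <= _ * X]big_nat_recr//= !mulrDr.
have /andP[] := Rintegral_nonincreasing_bounds h2 phi_ni.
have -> : a + k.+1%:R * delta - (a + k%:R * delta) = delta by rewrite -natr1; ring.
by move=> h3 h4; rewrite !lerD.
Qed.

Lemma Rintegral_restrict phi (D E : set R) : D `<=` E ->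
  (forall x, E x -> ~ D x -> phi x = 0) ->
  \int[mu]_(t in E) phi t = \int[mu]_(t in D) phi t.
Proof.
move=> DE phi0; rewrite Rintegral_mkcond [RHS]Rintegral_mkcond.
apply: eq_Rintegral => x _; rewrite !patchE.
case: ifPn => xE; case: ifPn => xD //.
- rewrite phi0//; first by move: xE; rewrite inE.
  by move: xD; rewrite notin_setE.
- by move: xE => /negP; case; rewrite inE; apply: DE; move: xD; rewrite inE.
Qed.

End riemann_sums.

Section choquet_riemann.
Context (R : realType) d (T : measurableType d).
Notation mu := (@lebesgue_measure R).
Implicit Types (nu : set T -> R) (f g : T -> R) (A B : set T).

Definition bounded_by f (C : R) := forall w, `|f w| <= C.

(** A right-endpoint, hence lower, Riemann sum of mesh [delta] on the range from [- m * delta] to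
    [m * delta]. The term [m%:R] collects the [nu setT = 1] subtracted on the [m] cells of the
    negative half. *)
Definition riemann_choquet nu (delta : R) (m : nat) f : R :=
  delta * (\sum_(1 <= j < (m + m).+1) nu [set w | (j%:R - m%:R) * delta <= f w]
           - m%:R).

Lemma measurable_set_le f g : measurable_fun setT f -> measurable_fun setT g ->
  measurable [set w | f w <= g w].
Proof.
by move=> mf mg; rewrite -[X in measurable X]setTI; exact: measurable_fun_le.
Qed.

Lemma measurable_set_lt f g : measurable_fun setT f -> measurable_fun setT g ->
  measurable [set w | f w < g w].
Proof.
move=> mf mg; have := measurableC (measurable_set_le mg mf); congr measurable.
by apply/seteqP; split => w /=; rewrite ltNge => /negP.
Qed.

Lemma measurable_superlevel f t : measurable_fun setT f ->
  measurable [set w | t <= f w].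
Proof. by move=> mf; apply: measurable_set_le => //; exact: measurable_cst. Qed.

Lemma superlevel_nonincreasing nu f : capacity nu -> measurable_fun setT f ->
  nonincreasing_fun (fun t => nu [set w | t <= f w]).
Proof.
move=> [_ _ _ nu_mono] mf s t st; apply: nu_mono; try exact: measurable_superlevel.
by move=> w /=; exact: le_trans.
Qed.

Lemma choquet_riemann nu f delta m : capacity nu -> measurable_fun setT f ->
  0 <= delta -> bounded_by f (m%:R * delta) ->
  riemann_choquet nu delta m f <= choquet nu f <= riemann_choquet nu delta m f + delta.
Proof.
move=> cnu mf d0 fC; have [nu01 nu0 nuT nu_mono] := cnu.
pose phi t := nu [set w | t <= f w].
have phi_ni : nonincreasing_fun phi by exact: superlevel_nonincreasing.
have phi01 t : 0 <= phi t <= 1 by exact/nu01/measurable_superlevel.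
have phiE0 t : m%:R * delta < t -> phi t = 0.
  move=> mt; rewrite /phi (_ : [set _ | _] = set0)//; apply/seteqP; split => w//=.
  by rewrite leNgt (le_lt_trans _ mt)//; apply: le_trans (fC w); exact: ler_norm.
have phiE1 t : t <= - (m%:R * delta) -> phi t = 1.
  move=> mt; rewrite /phi (_ : [set _ | _] = setT)//; apply/seteqP; split => w//= _.
  by apply: (le_trans mt); have := fC w; rewrite ler_norml => /andP[].
pose psi t := phi t - 1.
have psi_ni : nonincreasing_fun psi by move=> s t st; rewrite lerD2r phi_ni.
have -> : choquet nu f = \int[mu]_(t in `[0, 0 + m%:R * delta[) phi t +
    \int[mu]_(t in `[- (m%:R * delta), - (m%:R * delta) + m%:R * delta[) psi t.
  rewrite /choquet nuT add0r addNr; congr (_ + _).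
    (* The interval is closed first: [phi] may be positive at [m%:R * delta] itself, and [phiE0]
       covers only larger thresholds. *)
    rewrite Rintegral_itv_bndo_bndc; last exact: nonincreasing_integrable.
    apply: Rintegral_restrict => x /=; first by rewrite !in_itv/= => /andP[->].
    rewrite !in_itv/= andbT => -> /= /negP; rewrite -ltNge; exact: phiE0.
  rewrite Rintegral_itv_bndo_bndc; last exact: nonincreasing_integrable.
  rewrite -Rintegral_itv_obnd_cbnd; last first.
    apply: integrableS (nonincreasing_integrable (- (m%:R * delta)) 1 psi_ni) => //.
    by apply: subset_itv; rewrite bnd_simp.
  apply: Rintegral_restrict => x /=; first by rewrite !in_itv/= => /andP[_ ->].
  rewrite !in_itv/= => -> /= /negP; rewrite andbT -leNgt => /phiE1.
  by rewrite /psi /phi => ->; rewrite subrr.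
have /andP[l1 u1] := Rintegral_riemann_bounds 0 m d0 phi_ni.
have /andP[l2 u2] := Rintegral_riemann_bounds (- (m%:R * delta)) m d0 psi_ni.
pose F j := phi ((j%:R - m%:R) * delta).
have -> : riemann_choquet nu delta m f =
    delta * (\sum_(1 <= j < m.+1) phi (0 + j%:R * delta)) +
    delta * (\sum_(1 <= j < m.+1) psi (- (m%:R * delta) + j%:R * delta)).
  rewrite -mulrDr /riemann_choquet; congr (_ * _).
  rewrite (big_cat_nat (n := m.+1))//= ?ltnS ?leq_addr//.
  rewrite -[in X in X + _ - _](_ : \sum_(1 <= j < m.+1) F j = \sum_(1 <= j < m.+1) _)//.
  have -> : \sum_(1 <= j < m.+1) psi (- (m%:R * delta) + j%:R * delta) =
     \sum_(1 <= j < m.+1) F j - m%:R.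
    rewrite /psi big_split/= sumrN; congr (_ - _).
      by apply: eq_bigr => j _; rewrite /F; congr phi; ring.
    by rewrite sumr_const_nat subn1.
  rewrite -addrA addrCA; congr (_ + _).
  rewrite -[X in \sum_(X <= _ < _) _]add1n -[(m + m).+1]addSn big_addn addnK.
  by apply: eq_bigr => j _; rewrite natrD addrK add0r.
apply/andP; split; first exact: lerD.
apply: (le_trans (lerD u1 u2)).
(* Left and right sums differ by the end values only. The contributions at 0 cancel between the two
   halves, leaving [delta] times [phi (- (m%:R * delta)) - phi (m%:R * delta)], at most [delta]. *)
have tele (h : nat -> R) k :
    \sum_(0 <= j < k) h j = \sum_(1 <= j < k.+1) h j + h 0 - h k.
  elim: k => [|k IH]; first by rewrite !big_geq// add0r subrr.
  by rewrite big_nat_recr//= [in RHS]big_nat_recr//= IH; ring.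
rewrite !tele mul0r !addr0 addNr add0r /psi.
have /andP[_ h1] := phi01 (- (m%:R * delta)); have /andP[h2 _] := phi01 (m%:R * delta).
set S1 := \sum_(_ <= _ < _) _; set S2 := \sum_(_ <= _ < _) _.
rewrite -subr_ge0 [X in 0 <= X](_ : _ =
  delta * (1 - phi (- (m%:R * delta)) + phi (m%:R * delta))); last by ring.
by rewrite mulr_ge0// addr_ge0// subr_ge0.
Qed.

End choquet_riemann.

(** * Superadditivity of the Choquet integral *)

(** A downward closed predicate holds on an initial segment, so counting its successes finds where
    it stops. It will be used for nested superlevel sets. *)
Lemma count_antitone (P : pred nat) (N : nat) : (forall j, P j.+1 -> P j) ->
  let p := count P (index_iota 1 N.+1) in
  (p <= N)%N /\ forall j, (0 < j <= N)%N -> P j = (j <= p)%N.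
Proof.
move=> Pd; rewrite /index_iota subn1/=; elim: N => [|N [pN IH]].
  by split=> // -[].
have -> : iota 1 N.+1 = iota 1 N ++ iota N.+1 1.
  by rewrite -{1}[N.+1]addn1 iotaD add1n.
rewrite count_cat/= addn0.
set p := count P (iota 1 N) in pN IH *; case: (boolP (P N.+1)) => PN /=; last first.
  rewrite addn0; split=> [|j]; first exact: leqW.
  move=> /andP[j0]; rewrite leq_eqVlt ltnS => /predU1P[->|jN].
    by rewrite (negbTE PN) ltnNge pN.
  by rewrite IH// j0.
have -> : p = N.
  apply/eqP; rewrite eqn_leq pN/=; case: (posnP N) => [->//|N0].
  by rewrite -IH ?N0 ?leqnn//; exact: Pd.
rewrite addn1; split=> // j /andP[_ jN]; rewrite jN.
(* Descent from [N.+1]; once the truncated subtraction reaches 0 it stays there and the claim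
   repeats. *)
have : forall k, P (N.+1 - k)%N.
  elim=> [|k IHk]; first by rewrite subn0.
  case: (posnP (N.+1 - k)%N) => [h|h]; first by rewrite subnS h/= -h.
  by rewrite subnS; apply: Pd; rewrite prednK.
by move=> /(_ (N.+1 - j)%N); rewrite subKn// -addn1.
Qed.

Lemma exists_mesh_bound (R : realType) (C delta : R) : 0 < delta ->
  exists m, C <= m%:R * delta.
Proof.
move=> d0; exists (Num.bound (`|C| / delta)).
apply: (le_trans (ler_norm C)); rewrite -ler_pdivrMr//.
by apply/ltW/archi_boundP; rewrite divr_ge0// ltW.
Qed.

Section choquet_functional.
Context (R : realType) d (T : measurableType d).
Implicit Types (nu : set T -> R) (f g : T -> R) (A B : set T) (s : seq (set T)).

Definition hits s (w : T) : nat := count (fun A => `[< A w >]) s.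
Arguments hits : simpl never.

Lemma measurable_hits s k : (forall A, A \in s -> measurable A) ->
  measurable [set w | (k <= hits s w)%N].
Proof.
elim: s k => [|B s IH] k ms.
  case: k => [|k]; [rewrite (_ : [set _ | _] = setT)//|rewrite (_ : [set _ | _] = set0)//];
  by apply/seteqP; split.
have mB : measurable B by apply: ms; rewrite mem_head.
have mL j : measurable [set w | (j <= hits s w)%N].
  by apply: IH => A As; apply: ms; rewrite in_cons As orbT.
rewrite (_ : [set _ | _] =
    [set w | (k <= hits s w)%N] `|` ([set w | (k.-1 <= hits s w)%N] `&` B)); last first.
  apply/seteqP; split => w /=; rewrite /hits/=; case: asboolP => Bw; rewrite ?add0n ?add1n.
  - by case: k => [|k] /=; [left|right].
  - by left.
  - by case=> [|[+ _]]; [exact: leqW|case: k].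
  - by case=> [|[_]].
by apply: measurableU => //; exact: measurableI.
Qed.

(* Replacing two sets by their union and intersection only increases the total
   mass, and rearranges any finite family into the chain of its counting levels. *)
Lemma convex_sum_le_hits nu s : capacity nu -> convex_capacity nu ->
  (forall A, A \in s -> measurable A) ->
  \sum_(A <- s) nu A <= \sum_(1 <= k < (size s).+1) nu [set w | (k <= hits s w)%N].
Proof.
move=> [_ nu0 nuT _] cvx; elim: s => [|B s IH] ms; first by rewrite big_nil big_geq.
have mB : measurable B by apply: ms; rewrite mem_head.
have ms' A : A \in s -> measurable A by move=> As; apply: ms; rewrite in_cons As orbT.
pose L k := [set w | (k <= hits s w)%N].
have mL k : measurable (L k) by exact: measurable_hits.
have LE k : [set w | (k.+1 <= hits (B :: s) w)%N] = L k.+1 `|` (L k `&` B).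
  apply/seteqP; split => w /=; rewrite /hits/=; case: asboolP => Bw; rewrite ?add0n ?add1n /L/=.
  - by right.
  - by left.
  - by case=> [|[]//]; exact: leqW.
  - by case=> [|[_]].
rewrite big_cons big_add1/=;
rewrite [X in _ <= X](_ : _ = \sum_(0 <= k < (size s).+1) nu (L k.+1 `|` (L k `&` B))); last first.
  by apply: eq_bigr => k _; rewrite LE.
(* Convexity is applied to [L k.+1] and [L k] intersected with [B]; as the levels decrease, their
   intersection is that of [L k.+1] with [B]. The terms in [B] then telescope to [nu B]. *)
apply: (@le_trans _ _ (\sum_(0 <= k < (size s).+1)
    (nu (L k.+1) + (nu (L k `&` B) - nu (L k.+1 `&` B))))); last first.
  apply: ler_sum => k _; rewrite addrA lerBlDr.
  have := cvx _ _ (mL k.+1) (measurableI _ _ (mL k) mB).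
  rewrite setIA (_ : L k.+1 `&` L k = L k.+1)//.
  by apply/setIidl => w /=; exact: ltnW.
rewrite big_split/= [X in _ <= _ + X](telescope_sumr_eq (fun k => - nu (L k `&` B)))//=; last first.
  by move=> k _; rewrite opprK addrC.
have L0 : L (size s).+1 = set0.
  by apply/seteqP; split => w //=; rewrite /L/= ltnNge /hits count_size.
rewrite L0 set0I (_ : L 0 `&` B = B); last by apply/setIidr => w _.
rewrite nu0 oppr0 sub0r opprK addrC lerD2r; apply: le_trans (IH ms') _.
by rewrite [X in _ <= X]big_nat_recr//= L0 nu0 addr0 big_add1.
Qed.

Definition levels (delta : R) (m : nat) f : seq (set T) :=
  [seq [set w | (j%:R - m%:R) * delta <= f w] | j <- index_iota 1 (m + m).+1].

Lemma levels_measurable delta m f : measurable_fun setT f ->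
  forall A, A \in levels delta m f -> measurable A.
Proof. by move=> mf A /mapP[j _ ->]; exact: measurable_superlevel. Qed.

(** The superlevel sets are nested, so the number containing [w] is the index of the last threshold
    not above [f w]. This discretises [f] with an error of one mesh by a combination of
    indicators. *)
Lemma hits_levels delta m f w : 0 <= delta -> `|f w| <= m%:R * delta ->
  ((hits (levels delta m f) w)%:R - m%:R) * delta <= f w <=
  ((hits (levels delta m f) w)%:R - m%:R) * delta + delta.
Proof.
move=> d0 fC; set p := hits _ _; pose P j := (j%:R - m%:R) * delta <= f w.
have pE : p = count P (index_iota 1 (m + m).+1).
  by rewrite /p /hits /levels count_map; apply: eq_count => j /=; rewrite asboolb.
have Pd j : P j.+1 -> P j.
  by apply: le_trans; rewrite ler_wpM2r// lerB// ler_nat.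
have [] := count_antitone (m + m) Pd; rewrite -pE => pm hP.
move: fC; rewrite ler_norml => /andP[f1 f2]; apply/andP; split.
  case: (posnP p) => [->|p0]; first by rewrite sub0r mulNr.
  by rewrite -/(P p) hP ?leqnn// p0 pm.
move: pm; rewrite leq_eqVlt => /predU1P[->|pm].
  by apply: (le_trans f2); rewrite natrD addrK lerDl.
have : ~~ P p.+1 by rewrite hP ?ltnn.
by rewrite /P -ltNge -natr1 => /ltW/le_trans; apply; lra.
Qed.

(** The levels of [f] and [g] are merged into one family and rearranged by [convex_sum_le_hits]. A
    point hit [k] times has [f + g] at least [k - 2m] meshes, so each counting level lies in a
    superlevel set of the sum, on a range twice as long. *)
Lemma riemann_choquet_superadditive nu delta m f g : capacity nu -> convex_capacity nu ->
  0 <= delta -> measurable_fun setT f -> measurable_fun setT g ->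
  bounded_by f (m%:R * delta) -> bounded_by g (m%:R * delta) ->
  riemann_choquet nu delta m f + riemann_choquet nu delta m g <=
  riemann_choquet nu delta (m + m) (fun w => f w + g w).
Proof.
move=> cnu cvx d0 mf mg fC gC; have [_ _ _ nu_mono] := cnu.
rewrite /riemann_choquet -mulrDr; apply: ler_wpM2l => //.
pose s := levels delta m f ++ levels delta m g.
have ms A : A \in s -> measurable A.
  by rewrite mem_cat => /orP[]; exact: levels_measurable.
have ss : size s = (m + m + (m + m))%N.
  by rewrite size_cat !size_map !size_iota subn1.
have := convex_sum_le_hits cnu cvx ms.
rewrite big_cat/= !big_map ss addrACA -opprD -natrD lerD2r => /le_trans; apply.
apply: ler_sum => k _; apply: nu_mono.
- exact: measurable_hits.
- by apply: measurable_superlevel; exact: measurable_funD.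
- move=> w /=; rewrite /hits count_cat -/(hits _ w) -/(hits _ w).
  have /andP[h1 _] := hits_levels d0 (fC w); have /andP[h2 _] := hits_levels d0 (gC w).
  rewrite -(ler_nat R) natrD => h; apply: le_trans (lerD h1 h2).
  rewrite -mulrDl ler_wpM2r// natrD; lra.
Qed.

Definition bounded_mfun f : Prop := measurable_fun setT f /\ exists C, bounded_by f C.

Lemma bounded_mfun_cst c : bounded_mfun (cst c).
Proof. by split; [exact: measurable_cst|exists `|c| => w]. Qed.

Lemma bounded_mfunD f g : bounded_mfun f -> bounded_mfun g ->
  bounded_mfun (fun w => f w + g w).
Proof.
move=> [mf [C fC]] [mg [D gD]]; split; first exact: measurable_funD.
by exists (C + D) => w; apply: (le_trans (ler_normD _ _)); exact: lerD.
Qed.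

Lemma bounded_mfunM f g : bounded_mfun f -> bounded_mfun g ->
  bounded_mfun (fun w => f w * g w).
Proof.
move=> [mf [C fC]] [mg [D gD]]; split; first exact: measurable_funM.
by exists (C * D) => w; rewrite normrM ler_pM.
Qed.

Lemma bounded_mfunN f : bounded_mfun f -> bounded_mfun (fun w => - f w).
Proof.
move=> [mf [C fC]]; split; first exact/measurable_funN.
by exists C => w; rewrite normrN.
Qed.

Lemma bounded_mfunB f g : bounded_mfun f -> bounded_mfun g ->
  bounded_mfun (fun w => f w - g w).
Proof. by move=> bf bg; apply: bounded_mfunD => //; exact: bounded_mfunN. Qed.

Lemma bounded_mfun_sum (I : Type) (r : seq I) (F : I -> T -> R) :
  (forall i, bounded_mfun (F i)) -> bounded_mfun (fun w => \sum_(i <- r) F i w).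
Proof.
move=> bF; elim: r => [|i r IH].
  by under eq_fun do rewrite big_nil; exact: bounded_mfun_cst.
by under eq_fun do rewrite big_cons; exact: bounded_mfunD.
Qed.

Lemma bounded_mfun_indic A : measurable A -> bounded_mfun \1_A.
Proof.
move=> mA; split; first exact: measurable_indic.
by exists 1 => w; rewrite indicE; case: (_ \in _); rewrite ?normr1 ?normr0.
Qed.

Context (nu : set T -> R) (cnu : capacity nu).

Lemma choquet_approx f (delta : R) : bounded_mfun f -> 0 < delta ->
  exists m, bounded_by f (m%:R * delta).
Proof.
move=> [mf [C fC]] d0; have [m Cm] := exists_mesh_bound C d0.
by exists m => w; exact: le_trans Cm.
Qed.

Lemma choquet_monotone f g : bounded_mfun f -> bounded_mfun g ->
  (forall w, f w <= g w) -> choquet nu f <= choquet nu g.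
Proof.
move=> [mf [C fC]] [mg [D gD]] fg; apply/ler_addgt0Pr => e e0.
have [m Hm] := exists_mesh_bound (Num.max C D) e0.
have fm : bounded_by f (m%:R * e).
  by move=> w; apply: le_trans (fC w) (le_trans _ Hm); rewrite le_max lexx.
have gm : bounded_by g (m%:R * e).
  by move=> w; apply: le_trans (gD w) (le_trans _ Hm); rewrite le_max lexx orbT.
have /andP[_ /le_trans] := choquet_riemann cnu mf (ltW e0) fm; apply.
have /andP[h _] := choquet_riemann cnu mg (ltW e0) gm.
rewrite lerD2r; apply: le_trans h; apply: ler_wpM2l; [exact: ltW|]; rewrite lerD2r.
apply: ler_sum => j _; have [_ _ _ nu_mono] := cnu.
apply: nu_mono; try exact: measurable_superlevel.
by move=> w /= /le_trans; apply.
Qed.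

Lemma choquet_scale f c : bounded_mfun f -> 0 < c ->
  choquet nu (fun w => c * f w) = c * choquet nu f.
Proof.
(* Scaling the function and the mesh together leaves the superlevel sets unchanged. The reverse
   inequality is this one with factor [c^-1]. *)
have key g b : bounded_mfun g -> 0 < b -> choquet nu (fun w => b * g w) <= b * choquet nu g.
  move=> bg b0; have [mg _] := bg; apply/ler_addgt0Pr => e e0.
  have e0' : 0 < e / b by rewrite divr_gt0.
  have [m gm] := choquet_approx bg e0'.
  have mbg : measurable_fun setT (fun w => b * g w) by exact: measurable_funM.
  have bgm : bounded_by (fun w => b * g w) (m%:R * e).
    move=> w; rewrite normrM gtr0_norm// -ler_pdivlMl// mulrCA.
    by apply: le_trans (gm w) _; rewrite [b^-1 * e]mulrC.
  have /andP[_ /le_trans] := choquet_riemann cnu mbg (ltW e0) bgm; apply.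
  rewrite lerD2r.
  have /andP[h _] := choquet_riemann cnu mg (ltW e0') gm.
  apply: le_trans (ler_wpM2l (ltW b0) h).
  rewrite /riemann_choquet mulrA [b * (e / b)]mulrC divfK ?gt_eqF//.
  apply: ler_wpM2l; [exact: ltW|]; rewrite lerD2r; apply: ler_sum => j _.
  rewrite (_ : [set w | _] = [set w | (j%:R - m%:R) * (e / b) <= g w])//.
  by apply/funext => w /=; rewrite mulrA ler_pdivrMr// [b * _]mulrC.
move=> bf c0; apply/eqP; rewrite eq_le key//=.
rewrite -ler_pdivlMl//; apply: le_trans (key _ _ _ _); rewrite ?invr_gt0//.
  by under [in X in _ <= X]eq_fun do rewrite mulKf ?gt_eqF//.
by apply: bounded_mfunM => //; exact: bounded_mfun_cst.
Qed.

(** With mesh [n.+1%:R^-1], the thresholds in ]-1, 0] all cut out the set [0 <= f] and those in ]0,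
    1] the set [1 <= f], so the Riemann sum does not depend on [n]. This one formula serves
    indicators, their negatives, constants and coboundaries of indicators. *)
Lemma choquet_pm1 f : measurable_fun setT f ->
  (forall w, [|| f w == -1, f w == 0 | f w == 1]) ->
  choquet nu f = nu [set w | 0 <= f w] + nu [set w | 1 <= f w] - 1.
Proof.
move=> mf f3; have f_le1 : bounded_by f 1.
  by move=> w; case/or3P: (f3 w) => /eqP ->; rewrite ?normrN ?normr1 ?normr0.
have rE n : riemann_choquet nu n.+1%:R^-1 n.+1 f =
    nu [set w | 0 <= f w] + nu [set w | 1 <= f w] - 1.
  have n0 : 0 < n.+1%:R :> R by rewrite ltr0n.
  have lev j t : (t - 1) * n.+1%:R < j -> j <= t * n.+1%:R -> t = 0 \/ t = 1 ->
      [set w | j / n.+1%:R <= f w] = [set w | t <= f w].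
    rewrite -ltr_pdivlMr// -ler_pdivrMr// => h1 h2 t01.
    apply/funext => w /=; apply/propext; move: h1 h2.
    set y := j / n.+1%:R => h1 h2; split=> h; last exact: le_trans h.
    by case/or3P: (f3 w) => /eqP fw; rewrite fw in h *; case: t01 => t01; subst t; lra.
  rewrite /riemann_choquet (big_cat_nat (n := n.+2))//= ?ltnS ?leq_addr//.
  rewrite (eq_big_nat _ _ (F2 := fun=> nu [set w | 0 <= f w])); last first.
    move=> j /andP[j1 jn]; congr (nu _); apply: lev; last by left.
      by rewrite sub0r mulN1r ltrBrDr addNr ltr0n.
    by rewrite mul0r subr_le0 ler_nat.
  rewrite [\sum_(n.+2 <= _ < _) _](eq_big_nat _ _ (F2 := fun=> nu [set w | 1 <= f w])); last first.
    move=> j /andP[j1 jn]; congr (nu _); apply: lev; last by right.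
      by rewrite subrr mul0r subr_gt0 ltr_nat.
    by rewrite mul1r lerBlDr -natrD ler_nat -ltnS.
  rewrite !sumr_const_nat subn1 (_ : (_ - n.+2 = n.+1)%N); last by rewrite subSS addnK.
  rewrite /= -[nu [set w | 0 <= _] *+ _]mulr_natl -[nu [set w | 1 <= _] *+ _]mulr_natl.
  by rewrite -mulrDr -[X in _ - X]mulr1 -mulrBr mulKf// pnatr_eq0.
set v := _ - 1 in rE *.
have bnd n : v <= choquet nu f <= v + n.+1%:R^-1.
  rewrite -(rE n); apply: choquet_riemann => //.
  by move=> w; rewrite mulfV// pnatr_eq0.
apply/eqP; rewrite eq_le; have /andP[-> _] := bnd 0; rewrite andbT.
apply/ler_addgt0Pr => e e0; pose n := Num.bound e^-1.
have /andP[_ /le_trans] := bnd n; apply; rewrite lerD2l.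
rewrite invf_ple ?posrE//; apply/ltW; apply: lt_le_trans (archi_boundP _) _.
  by rewrite invr_ge0 ltW.
by rewrite ler_nat.
Qed.

Lemma choquet_indic A : measurable A -> choquet nu \1_A = nu A.
Proof.
move=> mA; have [_ _ nuT _] := cnu; rewrite choquet_pm1; first last.
- by move=> w; rewrite indicE; case: (_ \in _); rewrite eqxx ?orbT.
- exact: measurable_indic.
rewrite (_ : [set w | 0 <= _] = setT); last first.
  by apply/seteqP; split => w //= _; rewrite indicE.
rewrite (_ : [set w | 1 <= _] = A); first by rewrite nuT addrAC subrr add0r.
apply/seteqP; split => w /=; rewrite indicE.
  by have [/set_mem//|] := boolP (w \in A); rewrite ler10.
by move=> Aw; rewrite mem_set.
Qed.

Lemma choquet_indicN A : measurable A ->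
  choquet nu (fun w => - \1_A w) = nu (~` A) - 1.
Proof.
move=> mA; have [_ nu0 _ _] := cnu; rewrite choquet_pm1; first last.
- by move=> w; rewrite indicE; case: (_ \in _); rewrite ?oppr0 eqxx ?orbT.
- by apply/measurable_funN; exact: measurable_indic.
rewrite (_ : [set w | 1 <= _] = set0); last first.
  by apply/seteqP; split => w //=; rewrite lerNr => /(le_trans (ler0n _ _)); rewrite ler0N1.
rewrite nu0 addr0 (_ : [set w | _] = ~` A)//.
apply/seteqP; split => w /=; rewrite indicE oppr_ge0.
  by have [_|/negP h _ Aw] := boolP (w \in A); rewrite ?ler10//; apply: h; rewrite inE.
by move=> Aw; rewrite memNset.
Qed.

Lemma choquet_cst c : choquet nu (cst c) = c.
Proof.
have [_ nu0 nuT _] := cnu.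
have cstT b : choquet nu (cst b) = b -> forall c, 0 < c -> choquet nu (cst (c * b)) = c * b.
  by move=> h e e0; rewrite -[in RHS]h -choquet_scale//; exact: bounded_mfun_cst.
have [c0|c0|->] := ltgtP c 0.
- rewrite -[c]opprK -[- - c]mulrN1; apply: cstT; rewrite ?oppr_gt0//.
  rewrite choquet_pm1; [|exact: measurable_cst|by move=> w; rewrite eqxx].
  rewrite (_ : [set _ | _] = set0) ?nu0; last first.
    by apply/seteqP; split => w //=; rewrite ler0N1.
  rewrite (_ : [set _ | _] = set0) ?nu0 ?add0r//.
  by apply/seteqP; split => w //=; rewrite lerNr => /(le_trans (ler0n _ 1)); rewrite ler0N1.
- rewrite -[c]mulr1; apply: cstT => //.
  have := choquet_indic (@measurableT _ T); rewrite indicT nuT; exact.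
- have := choquet_indic (@measurable0 _ T); rewrite indic0 nu0; exact.
Qed.

Hypothesis cvx : convex_capacity nu.

Lemma choquet_superadditive f g : bounded_mfun f -> bounded_mfun g ->
  choquet nu f + choquet nu g <= choquet nu (fun w => f w + g w).
Proof.
move=> [mf [C fC]] [mg [D gD]]; apply/ler_addgt0Pr => e' e'0.
(* The upper Riemann bounds for [f] and for [g] each cost one mesh. *)
pose e := e' / 2; have e0 : 0 < e by rewrite divr_gt0.
have [m Hm] := exists_mesh_bound (Num.max C D) e0.
have fm : bounded_by f (m%:R * e).
  by move=> w; apply: le_trans (fC w) (le_trans _ Hm); rewrite le_max lexx.
have gm : bounded_by g (m%:R * e).
  by move=> w; apply: le_trans (gD w) (le_trans _ Hm); rewrite le_max lexx orbT.
have fgm : bounded_by (fun w => f w + g w) ((m + m)%:R * e).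
  by move=> w; apply: (le_trans (ler_normD _ _)); rewrite natrD mulrDl lerD.
have /andP[_ h1] := choquet_riemann cnu mf (ltW e0) fm.
have /andP[_ h2] := choquet_riemann cnu mg (ltW e0) gm.
have /andP[h3 _] := choquet_riemann cnu (measurable_funD mf mg) (ltW e0) fgm.
have h4 := riemann_choquet_superadditive cnu cvx (ltW e0) mf mg fm gm.
have : e' = e + e by rewrite /e; lra.
by rewrite /= in h3 h4 *; lra.
Qed.

Lemma choquet_sum_ge0 (I : Type) (r : seq I) (F : I -> T -> R) :
  (forall i, bounded_mfun (F i)) -> (forall i, 0 <= choquet nu (F i)) ->
  0 <= choquet nu (fun w => \sum_(i <- r) F i w).
Proof.
move=> bF F0; elim: r => [|i r IH].
  by under eq_fun do rewrite big_nil; rewrite choquet_cst.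
under eq_fun do rewrite big_cons.
apply: le_trans (choquet_superadditive _ _) => //; first exact: addr_ge0.
exact: bounded_mfun_sum.
Qed.

End choquet_functional.

(** * Continuity of the capacity *)

Section continuity.
Context (R : realType) d (T : measurableType d).
Implicit Types (f g : T -> R) (A B : set T).

Context (nu : set T -> R) (cnu : capacity nu) (cvx : convex_capacity nu).
Hypothesis cont : continuous_at_setT nu.

Lemma continuous_at_setT_le (A : nat -> set T) c :
  (forall n, measurable (A n)) -> (forall n, A n `<=` A n.+1) ->
  \bigcup_n A n = setT -> (forall n, nu (A n) <= c) -> 1 <= c.
Proof.
move=> mA iA uA Ac; have h := cont mA iA uA.
rewrite -(cvg_lim _ h)//; apply: limr_le; first exact: cvgP h.
exact: nearW.
Qed.

(** Convexity keeps full capacity under finite intersections [F n]. Continuity at [setT] concerns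
    increasing sequences only, so it is applied to the complement of [F n] joined with the whole
    intersection; convexity against [F n] shows that these sets have capacity at most that of the
    intersection. *)
Lemma capacity_full_bigcap (A : nat -> set T) : (forall n, measurable (A n)) ->
  (forall n, nu (A n) = 1) -> nu (\bigcap_n A n) = 1.
Proof.
have [nu01 nu0 nuT nu_mono] := cnu => mA A1.
have mE : measurable (\bigcap_n A n) by exact: bigcapT_measurable.
apply/eqP; rewrite eq_le; have /andP[_ ->] /= := nu01 _ mE.
pose F := fix F n := if n is k.+1 then F k `&` A k else setT.
have mF n : measurable (F n) by elim: n => [|n IH] //=; exact: measurableI.
have F1 n : nu (F n) = 1.
  elim: n => [|n IH] //=; apply/eqP; rewrite eq_le.
  have /andP[_ ->] /= := nu01 _ (measurableI _ _ (mF n) (mA n)).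
  have := cvx (mF n) (mA n); rewrite IH A1.
  by have /andP[_] := nu01 _ (measurableU _ _ (mF n) (mA n)); lra.
apply: (@continuous_at_setT_le (fun n => ~` F n `|` \bigcap_n A n)).
- by move=> n; apply: measurableU => //; exact: measurableC.
- by move=> n w [Fw|]; [left => -[]|right].
- apply/seteqP; split => w // _; have [Ew|] := pselect ((\bigcap_n A n) w).
    by exists 0%N => //; right.
  move=> /existsNP[k] /not_implyP[_ Akw]; exists k.+1 => //; left.
  by case.
- move=> n; have mB : measurable (~` F n `|` \bigcap_n A n).
    by apply: measurableU => //; exact: measurableC.
  have := cvx mB (mF n); rewrite F1.
  have /andP[_] := nu01 _ (measurableU _ _ mB (mF n)).
  have : nu ((~` F n `|` \bigcap_n A n) `&` F n) <= nu (\bigcap_n A n).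
    by apply: nu_mono => //; [exact: measurableI|move=> w [[]]].
  lra.
Qed.

(** A substitute for a limit theorem under the integral. On the sets [A N], which increase to
    [setT], [g] dominates [g_ N]; elsewhere it does so after subtracting a constant [L].
    Superadditivity bounds the integral of [g] below by [L * (nu (A N) - 1)]. *)
Lemma choquet_ge0_eventually (g_ : nat -> T -> R) g K : bounded_mfun g ->
  (forall n, bounded_mfun (g_ n)) -> (forall n, bounded_by (g_ n) K) ->
  (forall w, exists N, forall n, (N <= n)%N -> g_ n w <= g w) ->
  (forall n, 0 <= choquet nu (g_ n)) -> 0 <= choquet nu g.
Proof.
have [nu01 nu0 nuT nu_mono] := cnu.
move=> bg bg_ gK ev g0; have [mg [C gC]] := bg.
(* A point of [T] is what makes the bounds [K] and [C] nonnegative, hence [L] positive. *)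
have [w0|T0] := pselect (exists w : T, True); last first.
  rewrite (_ : g = cst 0) ?choquet_cst//.
  by apply/funext => w; case: T0; exists w.
pose L := K + C + 1.
have L0 : 0 < L.
  case: w0 => w _; rewrite /L.
  have := le_trans (normr_ge0 _) (gC w); have := le_trans (normr_ge0 _) (gK 0%N w); lra.
pose A N := \bigcap_(n in [set n | (N <= n)%N]) [set w | g_ n w <= g w].
have mA N : measurable (A N).
  apply: bigcap_measurable => [|n _]; first by exists N => /=.
  apply: measurable_set_le => //.
  by have [] := bg_ n.
(* The goal is brought to the form [1 <= c] of [continuous_at_setT_le], with [c] the integral of [g]
   divided by [L], plus 1. *)
rewrite -(ler_pM2r (x := L^-1)) ?invr_gt0// mul0r -(lerD2r 1) add0r.
apply: (@continuous_at_setT_le A) => //.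
- by move=> n w Anw k /= nk; apply: Anw => /=; exact: ltnW.
- apply/seteqP; split => w // _; have [N HN] := ev w; exists N => //.
- move=> N; rewrite -lerBlDr ler_pdivlMr//.
  have mAC := measurableC (mA N).
  have bi := bounded_mfunN (bounded_mfun_indic R mAC).
  have bLi : bounded_mfun (fun w => L * (- \1_(~` A N) w)).
    by apply: bounded_mfunM => //; exact: bounded_mfun_cst.
  rewrite -[A N]setCK mulrC -choquet_indicN// -choquet_scale//.
  have h := choquet_superadditive cnu cvx (bg_ N) bLi.
  apply: (@le_trans _ _ (choquet nu (fun w => g_ N w + L * - \1_(~` A N) w))).
    by apply: le_trans h; rewrite lerDr.
  apply: choquet_monotone => //; first exact: bounded_mfunD.
  move=> w; rewrite indicE; have [AC|] := boolP (w \in ~` A N).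
    have := gK N w; have := gC w; rewrite !ler_norml /L => /andP[? ?] /andP[? ?].
    by rewrite mulrN1; lra.
  rewrite notin_setE /setC/= => /contrapT /(_ N) /=; rewrite leqnn => /(_ isT).
  by rewrite oppr0 mulr0 addr0.
Qed.

End continuity.

(** * Limsup of bounded real sequences *)

Section limsup.
Context (R : realType).
Implicit Types (u v : R^nat).

Lemma bounded_seq u (C : R) : (forall n, `|u n| <= C) -> bounded_fun u.
Proof.
move=> uC; exists C; split; first exact: num_real.
by move=> M /ltW CM n _; exact: le_trans CM.
Qed.

Lemma limn_sup_gt u t N : bounded_fun u -> t < limn_sup u ->
  exists2 n, (N <= n)%N & t < u n.
Proof.
move=> bu; rewrite limn_supE// => tu.
have : t < sups u N.
  apply: lt_le_trans tu _; apply: ge_inf; last by exists N.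
  exact: bounded_fun_has_lbound_sups.
move=> /sup_gt[|_ [n /= Nn <-] tn]; last by exists n.
by exists (u N), N => /=.
Qed.

Lemma limn_sup_lt u t : bounded_fun u -> limn_sup u < t ->
  exists N, forall n, (N <= n)%N -> u n < t.
Proof.
move=> bu; rewrite limn_supE// => /inf_lt[|_ [N _ <-] Nt].
  by exists (sups u 0), 0%N.
exists N => n Nn; apply: le_lt_trans Nt; apply: ub_le_sup; last by exists n.
exact/has_ubound_sdrop/bounded_fun_has_ubound.
Qed.

Lemma limn_sup_bound u (C : R) : (forall n, `|u n| <= C) -> `|limn_sup u| <= C.
Proof.
move=> uC; have bu := bounded_seq uC; rewrite ler_norml; apply/andP; split.
  rewrite leNgt; apply/negP => /(limn_sup_lt bu)[N /(_ N (leqnn N))].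
  by have := uC N; rewrite ler_norml => /andP[+ _]; lra.
rewrite leNgt; apply/negP => /(limn_sup_gt 0 bu)[n _].
by have := uC n; rewrite ler_norml => /andP[_]; lra.
Qed.

(** The second limsup is minus the liminf of [u], so the hypothesis says that limsup is at most
    liminf. *)
Lemma limn_sup_cvg u : bounded_fun u -> limn_sup u + limn_sup (fun n => - u n) <= 0 ->
  u @ \oo --> limn_sup u.
Proof.
move=> bu h; have bNu : bounded_fun (fun n => - u n) by exact: bounded_funN.
apply/cvgrPdist_lt => e e0.
have [|N1 h1] := @limn_sup_lt u (limn_sup u + e) bu; first by rewrite ltrDl.
have [|N2 h2] := @limn_sup_lt _ (limn_sup (fun n => - u n) + e) bNu; first by rewrite ltrDl.
exists (maxn N1 N2) => // n /=; rewrite geq_max => /andP[/h1 ? /h2 ?].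
by rewrite ltr_norml; apply/andP; split; lra.
Qed.

Lemma limn_sup_addN_ge0 u : bounded_fun u -> 0 <= limn_sup u + limn_sup (fun n => - u n).
Proof.
move=> bu; have := le_limn_supD bu (bounded_funN bu).
rewrite (_ : u \+ _ = cst 0); last by apply/funext => n /=; rewrite subrr.
have cv0 : (cst 0 : R^nat) @ \oo --> (0 : R) by exact: cvg_cst.
by have [_ ->] := cvg_limn_inf_sup cv0.
Qed.

End limsup.

(** * The ergodic theorem for strongly invariant capacities *)

Section birkhoff.
Context (R : realType) d (T : measurableType d) (tau : T -> T).
Implicit Types (f g : T -> R).

Definition birkhoff_sum f n w : R := \sum_(0 <= k < n) f (iter k tau w).

Lemma birkhoff_avgE f w n : birkhoff_avg tau f w n = n%:R^-1 * birkhoff_sum f n w.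
Proof. by rewrite /birkhoff_avg big_add1. Qed.

Lemma birkhoff_avgN f w : birkhoff_avg tau (fun w => - f w) w =
  (fun n => - birkhoff_avg tau f w n).
Proof. by apply/funext => n; rewrite /birkhoff_avg sumrN mulrN. Qed.

Lemma birkhoff_avg_bound f C w n : bounded_by f C -> `|birkhoff_avg tau f w n| <= C.
Proof.
move=> fC; have C0 : 0 <= C by exact: le_trans (fC w).
rewrite birkhoff_avgE normrM normfV normr_nat.
case: n => [|n]; first by rewrite /birkhoff_sum big_geq// normr0 mulr0.
rewrite ler_pdivrMl ?ltr0n//. apply: le_trans (ler_norm_sum _ _ _) _.
apply: le_trans (ler_sum _ (fun k _ => fC (iter k tau w))) _.
by rewrite sumr_const_nat subn0 -[C *+ _]mulr_natl.
Qed.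

Definition birkhoff_limsup f w : R := limn_sup (birkhoff_avg tau f w).

Lemma birkhoff_limsup_bound f C : bounded_by f C -> bounded_by (birkhoff_limsup f) C.
Proof. by move=> fC w; apply: limn_sup_bound => n; exact: birkhoff_avg_bound. Qed.

(** The sums along [tau w] and [w] differ by two end terms only, so the averages differ by at most
    [(C + C) / n]. *)
Lemma birkhoff_avg_shift f C w : bounded_by f C ->
  birkhoff_avg tau f (tau w) n - birkhoff_avg tau f w n @[n --> \oo] --> (0 : R).
Proof.
move=> fC; have C0 : 0 <= C by exact: le_trans (fC w).
apply/cvgrPdist_le => e e0.
exists (Num.bound ((C + C) / e)).+1 => // n /= hn.
have n0 : 0 < n%:R :> R by rewrite ltr0n; exact: leq_trans hn.
rewrite sub0r normrN !birkhoff_avgE -mulrBr.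
have -> : birkhoff_sum f n (tau w) - birkhoff_sum f n w = f (iter n tau w) - f w.
  rewrite /birkhoff_sum; under eq_bigr do rewrite -iterSr.
  by rewrite -sumrB telescope_sumr.
rewrite normrM normfV (gtr0_norm n0) ler_pdivrMl//.
apply: (@le_trans _ _ (C + C)).
  by apply: (le_trans (ler_normB _ _)); exact: lerD.
rewrite -ler_pdivrMr//; apply/ltW/(lt_le_trans (archi_boundP _)).
  by rewrite divr_ge0 ?addr_ge0// ltW.
by rewrite ler_nat ltnW.
Qed.

Lemma birkhoff_limsup_invariant f C w : bounded_by f C ->
  birkhoff_limsup f (tau w) = birkhoff_limsup f w.
Proof.
move=> fC; have bA w' := bounded_seq (fun n => birkhoff_avg_bound w' n fC).
have h := birkhoff_avg_shift w fC.
have bh : bounded_fun (fun n => birkhoff_avg tau f (tau w) n - birkhoff_avg tau f w n).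
  by apply/cvg_seq_bounded; exact: cvgP h.
have h' : - (birkhoff_avg tau f (tau w) n - birkhoff_avg tau f w n) @[n --> \oo] --> (0 : R).
  by rewrite -oppr0; exact: cvgN.
have bh' : bounded_fun (fun n => - (birkhoff_avg tau f (tau w) n - birkhoff_avg tau f w n)).
  by apply/cvg_seq_bounded; exact: cvgP h'.
apply/eqP; rewrite eq_le; apply/andP; split.
  have := le_limn_supD (bA w) bh; have [_ ->] := cvg_limn_inf_sup h.
  rewrite addr0; congr (limn_sup _ <= _).
  by apply/funext => n /=; rewrite addrC subrK.
have := le_limn_supD (bA (tau w)) bh'; have [_ ->] := cvg_limn_inf_sup h'.
rewrite addr0; congr (limn_sup _ <= _).
by apply/funext => n /=; rewrite opprB addrC subrK.
Qed.

(** Some average exceeds its limsup minus [e], and the limsup is constant along the orbit, so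
    multiplying by [n] gives a positive sum. The index is required to be at least 1 because the
    average of index 0 is a convention. *)
Lemma birkhoff_sum_gt f C w e : bounded_by f C -> 0 < e ->
  exists n, 0 < birkhoff_sum (fun w => f w - birkhoff_limsup f w + e) n w.
Proof.
move=> fC e0.
have [||n n0 hn] := @limn_sup_gt _ (birkhoff_avg tau f w) (birkhoff_limsup f w - e) 1.
- by apply: bounded_seq => n; exact: birkhoff_avg_bound.
- by rewrite gtrBl.
exists n; have inv k : birkhoff_limsup f (iter k tau w) = birkhoff_limsup f w.
  by elim: k => [|k IH] //=; rewrite (birkhoff_limsup_invariant _ fC).
rewrite /birkhoff_sum; under eq_bigr do rewrite inv -addrA.
rewrite big_split/= sumr_const_nat subn0 -[_ *+ _]mulr_natl.
move: hn; rewrite birkhoff_avgE -(ltr_pM2l (x := n%:R)) ?ltr0n// mulVKf; last first.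
  by rewrite pnatr_eq0 -lt0n.
rewrite /birkhoff_sum; set S := \sum_(_ <= _ < _) _; move=> h.
by rewrite -[_ + e]opprK opprD opprK mulrN subr_gt0.
Qed.

(** The maximum of the Birkhoff sums of lengths 0 to [n], written recursively so that Garsia's
    comparison of [max_sum f n] with its composition by [tau] can be read off. *)
Fixpoint max_sum f (n : nat) (w : T) : R :=
  if n is k.+1 then Num.max 0 (f w + max_sum f k (tau w)) else 0.

Lemma max_sum_ge0 f n w : 0 <= max_sum f n w.
Proof. by case: n => [|n] //=; rewrite le_max lexx. Qed.

Lemma birkhoff_sum_le_max_sum f n k w : (k <= n)%N -> birkhoff_sum f k w <= max_sum f n w.
Proof.
elim: n k w => [|n IH] [|k] w //.
- by rewrite /birkhoff_sum big_geq.
- by rewrite /birkhoff_sum big_geq// max_sum_ge0.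
- rewrite ltnS => kn; rewrite /birkhoff_sum big_nat_recl//= le_max; apply/orP; right.
  by rewrite lerD2l; under eq_bigr do rewrite -iterS iterSr; exact: IH.
Qed.

Lemma max_sum_le_succ f n w : max_sum f n w <= max_sum f n.+1 w.
Proof.
elim: n w => [|n IH] w; first exact: max_sum_ge0.
by rewrite /= ge_max !le_max lexx/= lerD2l IH orbT.
Qed.

(** Where the maximum is positive it equals [f w] plus the previous maximum at [tau w], which is at
    most the current one there. Elsewhere it is 0, while its value at [tau w] is nonnegative. *)
Lemma max_sum_increment f n w :
  max_sum f n w - max_sum f n (tau w) <= f w * \1_[set w | 0 < max_sum f n w] w.
Proof.
rewrite indicE; have [|] := boolP (w \in _).
  rewrite inE/= mulr1; case: n => [|n]; first by rewrite ltxx.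
  have := max_sum_le_succ f n (tau w); move: (max_sum f n.+1 (tau w)) => /= m.
  rewrite lt_max ltxx/= => h h0; rewrite (max_idPr _); last exact: ltW.
  by rewrite lerBlDr lerD2l.
rewrite notin_setE/= mulr0 => /negP; rewrite -leNgt => h.
by rewrite subr_le0 (le_trans h)// max_sum_ge0.
Qed.

Hypothesis mtau : measurable_fun setT tau.

Lemma bounded_mfun_comp f : bounded_mfun f -> bounded_mfun (fun w => f (tau w)).
Proof.
move=> [mf [C fC]]; split; last by exists C => w.
exact: (measurableT_comp mf mtau).
Qed.

Lemma bounded_mfun_max_sum f n : bounded_mfun f -> bounded_mfun (max_sum f n).
Proof.
move=> bf; elim: n => [|n IH]; first exact: bounded_mfun_cst.
have [mg [C gC]] := bounded_mfunD bf (bounded_mfun_comp IH).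
split; first by apply: measurable_maxr => //; exact: measurable_cst.
exists C => w /=; rewrite ger0_norm ?le_max ?lexx// ge_max (le_trans _ (gC w))//=.
exact: le_trans (ler_norm _) (gC w).
Qed.

Lemma bounded_mfun_iter f k : bounded_mfun f -> bounded_mfun (fun w => f (iter k tau w)).
Proof.
move=> bf; elim: k => [|k IH] //; under eq_fun do rewrite iterSr.
exact: (bounded_mfun_comp IH).
Qed.

Lemma bounded_mfun_birkhoff_avg f n : bounded_mfun f ->
  bounded_mfun (fun w => birkhoff_avg tau f w n).
Proof.
move=> bf; apply: bounded_mfunM; first exact: bounded_mfun_cst.
by apply: bounded_mfun_sum => k; exact: bounded_mfun_iter.
Qed.

Lemma bounded_mfun_birkhoff_limsup f : bounded_mfun f -> bounded_mfun (birkhoff_limsup f).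
Proof.
move=> bf; have [mf [C fC]] := bf; split; last first.
  by exists C; exact: birkhoff_limsup_bound.
have bA w := bounded_seq (fun n => birkhoff_avg_bound w n fC).
apply: (measurable_fun_limn_sup (h := fun n w => birkhoff_avg tau f w n)) => //.
- by move=> w _; exact: bounded_fun_has_ubound (bA w).
- by move=> w _; exact: bounded_fun_has_lbound (bA w).
- by move=> n; have [] := bounded_mfun_birkhoff_avg n bf.
Qed.

(** * Maximal inequality and convergence of averages under strong invariance *)

Section strongly_invariant_capacity.
Context (nu : set T -> R) (cnu : capacity nu) (cvx : convex_capacity nu).
Hypotheses (cont : continuous_at_setT nu) (sinv : strongly_invariant tau nu).

(** The function takes the values -1, 0 and 1, so [choquet_pm1] expresses its integral through the
    two differences of [A] and its preimage; strong invariance makes these terms cancel. *)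
Lemma choquet_indic_coboundary A : measurable A ->
  choquet nu (fun w => \1_A w - \1_A (tau w)) = 0.
Proof.
move=> mA; have mtA : measurable (tau @^-1` A).
  by rewrite -[X in measurable X]setTI; exact: mtau.
have i1 (w : T) : \1_A w = (`[< A w >])%:R :> R.
  by [].
rewrite (choquet_pm1 cnu); first last.
- move=> w; rewrite !i1; case: asboolP => _; case: asboolP => _;
  by rewrite ?subrr ?subr0 ?sub0r eqxx ?orbT.
- have [mi _] := bounded_mfun_indic R mA.
  by apply: measurable_funB => //; exact: (measurableT_comp mi mtau).
have ge1 (a b : bool) : (1 <= a%:R - b%:R :> R) = a && ~~ b.
  by case: a b => -[] /=; rewrite ?mulr1n ?mulr0n; [|apply/idP|..];
    try apply/negbTE; rewrite -?ltNge; lra.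
have ge0 (a b : bool) : (0 <= a%:R - b%:R :> R) = ~~ (b && ~~ a).
  by case: a b => -[] /=; rewrite ?mulr1n ?mulr0n; [apply/idP|apply/idP| |apply/idP];
    try apply/negbTE; rewrite -?ltNge; lra.
have [h _] := sinv mA.
have -> : [set w | 1 <= \1_A w - \1_A (tau w) :> R] = A `\` tau @^-1` A.
  apply/seteqP; split => w /=; rewrite !i1 ge1.
    by move=> /andP[/asboolP ? /asboolP ?].
  by move=> [? ?]; apply/andP; split; apply/asboolP.
have -> : [set w | 0 <= \1_A w - \1_A (tau w) :> R] = ~` (tau @^-1` A `\` A).
  apply/seteqP; split => w /=; rewrite !i1 ge0.
    by move=> /negP h' [? ?]; apply: h'; apply/andP; split; apply/asboolP.
  by move=> h'; apply/negP => /andP[/asboolP ? /asboolP ?]; apply: h'.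
by rewrite h /conjugate; ring.
Qed.

Lemma hitsE s (w : T) : (hits s w)%:R = \sum_(A <- s) \1_A w :> R.
Proof.
elim: s => [|A s IH]; first by rewrite big_nil.
by rewrite big_cons -IH {1}/hits/= natrD.
Qed.

(** By [hits_levels], the coboundary of [f] is at least [e] times the sum [S] of the coboundaries of
    its level indicators, minus [e]. Superadditivity gives [S] a nonnegative integral, and [e] is
    arbitrary. *)
Lemma choquet_coboundary_ge0 f : bounded_mfun f ->
  0 <= choquet nu (fun w => f w - f (tau w)).
Proof.
move=> bf; have [mf _] := bf; apply/ler_addgt0Pr => e e0.
have [m fm] := choquet_approx bf e0.
pose lev j := [set w | (j%:R - m%:R) * e <= f w].
have mlev j : measurable (lev j) by exact: measurable_superlevel.
pose F j w : R := \1_(lev j) w - \1_(lev j) (tau w).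
have bF j : bounded_mfun (F j).
  have bi := bounded_mfun_indic R (mlev j).
  by apply: bounded_mfunB => //; exact: (bounded_mfun_comp bi).
pose S w := \sum_(j <- index_iota 1 (m + m).+1) F j w.
have bS : bounded_mfun S by exact: bounded_mfun_sum.
have S0 : 0 <= choquet nu S.
  apply: (choquet_sum_ge0 cnu cvx) => // j.
  by rewrite choquet_indic_coboundary.
have beS : bounded_mfun (fun w => e * S w).
  by apply: bounded_mfunM => //; exact: bounded_mfun_cst.
have bfd : bounded_mfun (fun w => f w - f (tau w)).
  by apply: bounded_mfunB => //; exact: (bounded_mfun_comp bf).
have := choquet_superadditive cnu cvx beS (bounded_mfun_cst T (- e)).
rewrite choquet_cst// choquet_scale// => h.
rewrite -lerBlDr sub0r.
apply: (@le_trans _ _ (choquet nu (fun w => e * S w + cst (- e) w))).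
  by apply: le_trans h; rewrite lerDr mulr_ge0// ltW.
apply: choquet_monotone => // [|w].
  by apply: bounded_mfunD => //; exact: bounded_mfun_cst.
have SE : S w = (hits (levels e m f) w)%:R - (hits (levels e m f) (tau w))%:R.
  by rewrite !hitsE /levels !big_map -sumrB.
rewrite /= SE; have /andP[h1 h2] := hits_levels (ltW e0) (fm w).
have /andP[h3 h4] := hits_levels (ltW e0) (fm (tau w)).
by lra.
Qed.

(** Restricted to [P n], [g] dominates the coboundary of [max_sum g n], so its integral is
    nonnegative. Every point eventually lies in [P n], which allows passing to [g] itself. *)
Lemma choquet_maximal g : bounded_mfun g ->
  (forall w, exists n, 0 < birkhoff_sum g n w) -> 0 <= choquet nu g.
Proof.
move=> bg gpos; have [mg [C gC]] := bg.
pose P n := [set w | 0 < max_sum g n w].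
have mP n : measurable (P n).
  apply: measurable_set_lt => //.
  by have [] := bounded_mfun_max_sum n bg.
have bgP n : bounded_mfun (fun w => g w * \1_(P n) w).
  by apply: bounded_mfunM => //; exact: bounded_mfun_indic.
apply: (choquet_ge0_eventually cnu cvx cont (g_ := fun n w => g w * \1_(P n) w) (K := C)) => //.
- move=> n w; rewrite normrM; apply: le_trans (gC w).
  by rewrite ler_piMr// indicE; case: (_ \in _); rewrite ?normr1 ?normr0.
- move=> w; have [N hN] := gpos w; exists N => n Nn.
  rewrite indicE mem_set ?mulr1//; apply: lt_le_trans hN _.
  exact: birkhoff_sum_le_max_sum.
- move=> n; have bM := bounded_mfun_max_sum n bg.
  apply: (le_trans (choquet_coboundary_ge0 bM)).
  apply: choquet_monotone => // [|w]; last exact: max_sum_increment.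
  by apply: bounded_mfunB => //; exact: (bounded_mfun_comp bM).
Qed.

Lemma choquet_sub_birkhoff_limsup f : bounded_mfun f ->
  0 <= choquet nu (fun w => f w - birkhoff_limsup f w).
Proof.
move=> bf; have [_ [C fC]] := bf; have bl := bounded_mfun_birkhoff_limsup bf.
have bd := bounded_mfunB bf bl.
apply/ler_addgt0Pr => e e0; have be := bounded_mfun_cst T e.
have bde := bounded_mfunD bd be.
(* Removing the added constant lowers the integral by at most [e]. *)
have := choquet_superadditive cnu cvx bde (bounded_mfun_cst T (- e)).
rewrite choquet_cst// [X in _ <= choquet nu X](_ : _ = fun w => f w - birkhoff_limsup f w).
  have : 0 <= choquet nu (fun w => f w - birkhoff_limsup f w + cst e w).
    by apply: choquet_maximal => // w; exact: birkhoff_sum_gt fC e0.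
  lra.
by apply/funext => w /=; rewrite addrK.
Qed.

(** For bounded [f] this is the set of convergence of the averages, written as limsup at most liminf
    so that its measurability follows from that of the limsups. *)
Definition birkhoff_cvg_set f : set T :=
  [set w | birkhoff_limsup f w + birkhoff_limsup (fun w => - f w) w <= 0].

Lemma measurable_birkhoff_cvg_set f : bounded_mfun f -> measurable (birkhoff_cvg_set f).
Proof.
move=> bf; have [m1 _] := bounded_mfun_birkhoff_limsup bf.
have [m2 _] := bounded_mfun_birkhoff_limsup (bounded_mfunN bf).
by apply: measurable_set_le => //; exact: measurable_funD.
Qed.

Lemma birkhoff_limsup_addN_ge0 f w : bounded_mfun f ->
  0 <= birkhoff_limsup f w + birkhoff_limsup (fun w => - f w) w.
Proof.
move=> [_ [C fC]]; rewrite /birkhoff_limsup birkhoff_avgN.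
by apply: limn_sup_addN_ge0; apply: bounded_seq => n; exact: birkhoff_avg_bound.
Qed.

Lemma birkhoff_cvg_setP f w : bounded_mfun f -> birkhoff_cvg_set f w ->
  birkhoff_avg tau f w n @[n --> \oo] --> birkhoff_limsup f w.
Proof.
move=> [_ [C fC]] h; apply: limn_sup_cvg.
  by apply: bounded_seq => n; exact: birkhoff_avg_bound.
by move: h; rewrite /birkhoff_cvg_set/= /birkhoff_limsup birkhoff_avgN.
Qed.

Lemma cvg_birkhoff_cvg_set f w : bounded_mfun f -> cvgn (birkhoff_avg tau f w) ->
  birkhoff_cvg_set f w.
Proof.
move=> [_ [C fC]] h; rewrite /birkhoff_cvg_set/= /birkhoff_limsup birkhoff_avgN.
have hN : - birkhoff_avg tau f w n @[n --> \oo] --> - limn (birkhoff_avg tau f w).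
  exact: cvgN.
have [_ ->] := cvg_limn_inf_sup h; have [_ ->] := cvg_limn_inf_sup hN.
by rewrite subrr.
Qed.

Lemma capacity_birkhoff_cvg_set f : bounded_mfun f -> nu (birkhoff_cvg_set f) = 1.
Proof.
move=> bf; have bNf := bounded_mfunN bf; have [nu01 nu0 nuT nu_mono] := cnu.
pose h w := birkhoff_limsup f w + birkhoff_limsup (fun w => - f w) w.
have bl := bounded_mfun_birkhoff_limsup bf.
have blN := bounded_mfun_birkhoff_limsup bNf.
have bh : bounded_mfun h by exact: bounded_mfunD.
have h0 w : 0 <= h w by exact: birkhoff_limsup_addN_ge0.
have Ih : 0 <= choquet nu (fun w => - h w).
  have := choquet_superadditive cnu cvx (bounded_mfunB bf bl) (bounded_mfunB bNf blN).
  rewrite [X in _ <= choquet nu X](_ : _ = fun w => - h w); last first.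
    by apply/funext => w; rewrite /h; ring.
  by apply: le_trans; rewrite addr_ge0// choquet_sub_birkhoff_limsup.
pose A k := [set w | h w < k.+1%:R^-1].
have [mh _] := bh.
have mA k : measurable (A k).
  by apply: measurable_set_lt => //; exact: measurable_cst.
have -> : birkhoff_cvg_set f = \bigcap_k A k.
  apply/seteqP; split => w.
    by move=> hw k _; apply: le_lt_trans hw _; rewrite invr_gt0 ltr0n.
  move=> Aw; rewrite /birkhoff_cvg_set/= -/(h w); apply/ler_addgt0Pr => e e0.
  rewrite add0r; apply/ltW/(lt_le_trans (Aw (Num.bound e^-1) I)).
  rewrite invf_ple ?posrE//; apply/ltW/(lt_le_trans (archi_boundP _)).
    by rewrite invr_ge0 ltW.
  by rewrite ler_nat.
apply: (capacity_full_bigcap cnu cvx cont) => // k.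
apply/eqP; rewrite eq_le; have /andP[_ ->] /= := nu01 _ (mA k).
have mAC := measurableC (mA k); have bi := bounded_mfunN (bounded_mfun_indic R mAC).
have k0 : 0 < k.+1%:R :> R by rewrite ltr0n.
(* Chebyshev's argument: [h] is at least [k.+1%:R^-1] off [A k], so the scaled negative indicator
   dominates [- h]. *)
have : 0 <= choquet nu (fun w => - \1_(~` A k) w).
  rewrite -(pmulr_rge0 _ (x := k.+1%:R^-1)) ?invr_gt0// -choquet_scale ?invr_gt0//.
  apply: (le_trans Ih); apply: choquet_monotone => //; first exact: bounded_mfunN.
    by apply: bounded_mfunM => //; exact: bounded_mfun_cst.
  move=> w; rewrite mulrN lerN2 indicE; have [|_] := boolP (w \in _).
    by rewrite inE /A/= mulr1 => /negP; rewrite -leNgt.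
  by rewrite mulr0.
by rewrite choquet_indicN// setCK subr_ge0.
Qed.

(** Superadditivity for the limsup and [f] minus the limsup gives one inequality. For the other,
    adding [- f - birkhoff_limsup (- f)] to [f] leaves the liminf, which is at most the limsup. *)
Lemma choquet_birkhoff_limsup f : bounded_mfun f ->
  choquet nu (birkhoff_limsup f) = choquet nu f.
Proof.
move=> bf; have bNf := bounded_mfunN bf; have bl := bounded_mfun_birkhoff_limsup bf.
have blN := bounded_mfun_birkhoff_limsup bNf.
apply/eqP; rewrite eq_le; apply/andP; split.
  have := choquet_superadditive cnu cvx bl (bounded_mfunB bf bl).
  rewrite [X in _ <= choquet nu X](_ : _ = f); last first.
    by apply/funext => w; rewrite addrC subrK.
  by have := choquet_sub_birkhoff_limsup bf; lra.
have := choquet_superadditive cnu cvx bf (bounded_mfunB bNf blN).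
have := choquet_sub_birkhoff_limsup bNf.
have : choquet nu (fun w => f w + (- f w - birkhoff_limsup (fun w => - f w) w)) <=
    choquet nu (birkhoff_limsup f).
  apply: choquet_monotone => //.
    by apply: bounded_mfunD => //; exact: bounded_mfunB.
  by move=> w; have := birkhoff_limsup_addN_ge0 w bf; lra.
lra.
Qed.

End strongly_invariant_capacity.
End birkhoff.

(** * Ergodic capacities and invariant probabilities *)

Section conjugate.
Context (R : realType) d (T : measurableType d).
Context (nu : set T -> R) (cnu : capacity nu).

Lemma capacity_conjugate : capacity (conjugate nu).
Proof.
have [nu01 nu0 nuT nu_mono] := cnu; split; rewrite /conjugate.
- move=> A mA; have /andP[h1 h2] := nu01 _ (measurableC mA).
  by rewrite subr_ge0 h2 lerBlDr lerDl.
- by rewrite setC0 nuT subrr.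
- by rewrite setCT nu0 subr0.
- move=> A B mA mB AB; rewrite lerD2l lerN2.
  by apply: nu_mono; [exact: measurableC|exact: measurableC|exact: subsetC].
Qed.

(** The complement of [t <= f] lies in the superlevel set of [- f] at [- t], so the two Riemann sums
    match after reversing the thresholds, up to one mesh. *)
Lemma choquetN_le_conjugate f : bounded_mfun f ->
  - choquet nu (fun w => - f w) <= choquet (conjugate nu) f.
Proof.
have [nu01 nu0 nuT nu_mono] := cnu => bf; have [mf _] := bf.
have [mNf _] := bounded_mfunN bf; apply/ler_addgt0Pr => e e0.
have [m fm] := choquet_approx bf e0.
have Nfm : bounded_by (fun w => - f w) (m%:R * e) by move=> w; rewrite normrN.
have /andP[h1 _] := choquet_riemann cnu mNf (ltW e0) Nfm.
have /andP[h2 _] := choquet_riemann capacity_conjugate mf (ltW e0) fm.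
suff h : - riemann_choquet nu e m (fun w => - f w) <=
    riemann_choquet (conjugate nu) e m f + e by lra.
pose a j := nu [set w | (m%:R - j%:R) * e <= - f w].
have a01 j : 0 <= a j <= 1 by apply: nu01; exact: measurable_superlevel.
have s1 : \sum_(1 <= j < (m + m).+1) nu [set w | (j%:R - m%:R) * e <= - f w] =
    \sum_(0 <= j < m + m) a j.
  rewrite big_add1/= big_nat_rev/= add0n; apply: eq_big_nat => j /andP[_ jm].
  have -> : (m + m - j.+1).+1%:R - m%:R = m%:R - j%:R :> R.
    by rewrite subnSK// natrB ?(ltnW jm)// natrD; ring.
  by [].
have s2 : \sum_(1 <= j < (m + m).+1) conjugate nu [set w | (j%:R - m%:R) * e <= f w] >=
    (m + m)%:R - \sum_(1 <= j < (m + m).+1) a j.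
  have -> : (m + m)%:R = \sum_(1 <= j < (m + m).+1) (1 : R).
    by rewrite sumr_const_nat subn1.
  rewrite -sumrB; apply: ler_sum => j _; rewrite /conjugate lerD2l lerN2.
  apply: nu_mono; [exact/measurableC/measurable_superlevel|exact: measurable_superlevel|].
  by move=> w /= /negP; rewrite -ltNge => /ltW h; rewrite lerNr -mulNr opprB.
(* Reversal turns indices 1 to [m + m] into 0 to [m + m - 1]; the shift exchanges one value of [a],
   in [0, 1], for another. *)
have s3 : \sum_(1 <= j < (m + m).+1) a j <= \sum_(0 <= j < m + m) a j + 1.
  have /andP[a0 _] := a01 0%N; have /andP[_ a1] := a01 (m + m)%N.
  rewrite -(lerD2l (a 0%N)) -big_ltn// big_nat_recr//=; lra.
rewrite /riemann_choquet s1 -subr_ge0.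
set S := \sum_(_ <= _ < _) conjugate _ _ in s2 *.
rewrite [X in 0 <= X](_ : _ =
  e * (S + \sum_(0 <= j < m + m) a j + 1 - (m + m)%:R)); last by rewrite natrD; ring.
by rewrite mulr_ge0 ?(ltW e0)//; lra.
Qed.

Hypotheses (cvx : convex_capacity nu) (cont : continuous_at_setT nu).

(** With [K] above every value of [f - s], the function [f - s] is at most [K] times the indicator
    of a null set; superadditivity with the constant [- s] finishes. *)
Lemma choquet_le_of_null f s : bounded_mfun f -> nu [set w | s <= f w] = 0 ->
  choquet nu f <= s.
Proof.
move=> bf nuA; have [mf [C fC]] := bf.
pose A := [set w | s <= f w]; have mA : measurable A by exact: measurable_superlevel.
have bi := bounded_mfun_indic R mA; pose K := `|C| + `|s| + 1.
have K0 : 0 < K by rewrite ltr_pwDr ?addr_ge0.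
have bKi : bounded_mfun (fun w => K * \1_A w).
  by apply: bounded_mfunM => //; exact: bounded_mfun_cst.
have bs := bounded_mfun_cst T (- s).
have := choquet_superadditive cnu cvx bf bs; rewrite choquet_cst//.
have : choquet nu (fun w => f w + cst (- s) w) <= choquet nu (fun w => K * \1_A w).
  apply: choquet_monotone => // [|w]; first exact: bounded_mfunD.
  rewrite /= indicE; have [_|] := boolP (w \in A).
    have := fC w; have := ler_norm C; have := ler_norm (- s).
    by rewrite normrN ler_norml /K mulr1 => ? ? /andP[]; lra.
  rewrite notin_setE /A/= => /negP; rewrite -ltNge mulr0 => ?; lra.
by rewrite choquet_scale// choquet_indic// nuA mulr0; lra.
Qed.

Context (tau : T -> T).

Lemma invariant_sets_superlevel (f : T -> R) t : bounded_mfun f -> (forall w, f (tau w) = f w) ->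
  invariant_sets tau [set w | t <= f w].
Proof.
move=> [mf _] ft; split; first exact: measurable_superlevel.
by apply/funext => w /=; rewrite ft.
Qed.

(** Superlevel sets of an invariant function have capacity 0 or 1. At a level strictly below the
    integral, capacity 0 would contradict [choquet_le_of_null]; countably many such levels reach the
    integral. *)
Lemma ergodic_superlevel f : ergodic tau nu -> bounded_mfun f ->
  (forall w, f (tau w) = f w) -> nu [set w | choquet nu f <= f w] = 1.
Proof.
move=> erg bf ft; have [mf _] := bf.
pose A k := [set w | choquet nu f - k.+1%:R^-1 <= f w].
have -> : [set w | choquet nu f <= f w] = \bigcap_k A k.
  apply/seteqP; split => w /=.
    by move=> h k _; rewrite /A/= lerBlDr (le_trans h)// lerDl.
  move=> Aw; apply/ler_addgt0Pr => e e0; rewrite -lerBlDr.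
  apply: le_trans (Aw (Num.bound e^-1) I); rewrite lerD2l lerN2.
  rewrite invf_ple ?posrE//; apply/ltW/(lt_le_trans (archi_boundP _)).
    by rewrite invr_ge0 ltW.
  by rewrite ler_nat.
apply: (capacity_full_bigcap cnu cvx cont) => k; first exact: measurable_superlevel.
have : [set 0; 1] (nu (A k)).
  by rewrite -erg; exists (A k) => //; exact: invariant_sets_superlevel.
case=> [/(choquet_le_of_null bf)|//].
by rewrite leNgt gtrBl invr_gt0 ltr0n.
Qed.

End conjugate.

(** * Invariant probabilities as strongly invariant capacities *)

Section invariant_probability.
Context (R : realType) d (T : measurableType d) (tau : T -> T) (P : probability T R).
Hypotheses (mtau : measurable_fun setT tau) (invP : invariant_probability tau P).

Let nuP (A : set T) : R := fine (P A).

Let fin A : measurable A -> P A \is a fin_num.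
Proof. by move=> mA; exact: fin_num_measure. Qed.

Lemma capacity_probability : capacity nuP.
Proof.
split.
- move=> A mA; rewrite fine_ge0//= -lee_fin fineK ?fin//.
  exact: probability_le1.
- by rewrite /nuP measure0.
- by rewrite /nuP probability_setT.
- move=> A B mA mB AB; apply: fine_le; rewrite ?fin//.
  by apply: le_measure; rewrite ?inE.
Qed.

Lemma convex_probability : convex_capacity nuP.
Proof.
move=> A B mA mB; rewrite /nuP measureUfinl//; last first.
  by rewrite ltey_eq fin.
have mAB := measurableI _ _ mA mB.
by rewrite fineB ?fin_numD ?fin// fineD ?fin// subrK.
Qed.

Lemma continuous_at_setT_probability : continuous_at_setT nuP.
Proof.
move=> A mA iA uA; apply: (fine_cvg (f := P \o A)).
rewrite -(probability_setT P) -uA; apply: nondecreasing_cvg_mu => //.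
  by rewrite uA.
by apply/nondecreasing_seqP => n; apply/subsetPset/iA.
Qed.

(** Removing the common intersection from [A] and its preimage, which have equal mass, leaves two
    differences of equal mass; and a probability is its own conjugate. *)
Lemma strongly_invariant_probability : strongly_invariant tau nuP.
Proof.
move=> A mA; have mB : measurable (tau @^-1` A).
  by rewrite -[X in measurable X]setTI; exact: mtau.
have e : P (A `\` tau @^-1` A) = P (tau @^-1` A `\` A).
  have h1 : P A = (P (A `\` tau @^-1` A) + P (A `&` tau @^-1` A))%E := measureDI P mA mB.
  have h2 : P (tau @^-1` A) = (P (tau @^-1` A `\` A) + P (A `&` tau @^-1` A))%E.
    by rewrite setIC; exact: measureDI.
  move: h1; rewrite (invP mA) h2.
  have mI := measurableI _ _ mA mB.
  have := fin (measurableD mA mB); have := fin (measurableD mB mA); have := fin mI.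
  by do 3 move=> /fineK <-; rewrite -!EFinD => -[/addIr ->].
have conjE B : measurable B -> conjugate nuP B = nuP B.
  move=> mB'; rewrite /conjugate /nuP probability_setC// fineB ?fin//= opprB addrC subrK//.
by split; rewrite conjE ?/nuP ?e//; exact: measurableD.
Qed.

Lemma bounded_mfun_integrable (f : T -> R) A : measurable A -> bounded_mfun f ->
  P.-integrable A (EFin \o f).
Proof.
move=> mA [mf [C fC]]; apply: measurable_bounded_integrable => //.
- by rewrite ltey_eq fin.
- exact: measurable_funTS.
- exists C; split; first exact: num_real.
  by move=> M /ltW CM w _; exact: le_trans CM.
Qed.

Lemma Rintegral_comp_invariant (f : T -> R) A : bounded_mfun f -> measurable A -> tau @^-1` A = A ->
  \int[P]_(w in A) f (tau w) = \int[P]_(w in A) f w.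
Proof.
move=> bf mA tA; rewrite /Rintegral; congr fine.
have [mf _] := bf; have mEf : measurable_fun setT (EFin \o f) by exact/measurable_EFinP.
rewrite -[in LHS]tA -(integral_pushforward mtau mEf)//; last first.
  apply: (bounded_mfun_integrable (f := f \o tau)); rewrite ?tA//.
  exact: (bounded_mfun_comp mtau bf).
apply: eq_measure_integral => B mB _.
by rewrite [RHS]invP.
Qed.

Lemma Rintegral_birkhoff_sum (f : T -> R) A n : bounded_mfun f -> measurable A -> tau @^-1` A = A ->
  \int[P]_(w in A) birkhoff_sum tau f n w = n%:R * \int[P]_(w in A) f w.
Proof.
move=> bf mA tA.
have bfk k := bounded_mfun_iter mtau k bf.
have Ek k : \int[P]_(w in A) f (iter k tau w) = \int[P]_(w in A) f w.
  elim: k => [|k IH] //; rewrite -IH; under eq_Rintegral do rewrite iterSr.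
  exact: (Rintegral_comp_invariant (bfk k)).
elim: n => [|n IH].
  rewrite mul0r; under eq_Rintegral do rewrite /birkhoff_sum big_geq//.
  by rewrite Rintegral_cst// mul0r.
under eq_Rintegral do rewrite /birkhoff_sum big_nat_recr//=.
rewrite RintegralD//; try exact: bounded_mfun_integrable.
  by rewrite IH Ek -natr1 mulrDl mul1r.
by apply: bounded_mfun_integrable => //; apply: bounded_mfun_sum.
Qed.

(** Over an invariant set every average has the same integral as [f]. The averages converge almost
    surely by the capacity result applied to [P], and dominated convergence with a constant bound
    passes to the limit. *)
Lemma is_cond_exp_birkhoff_limsup (f : T -> R) : bounded_mfun f ->
  (forall B : set R, measurable B -> invariant_sets tau (birkhoff_limsup tau f @^-1` B)) ->
  is_cond_exp P (invariant_sets tau) f (birkhoff_limsup tau f).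
Proof.
move=> bf mG; have bl := bounded_mfun_birkhoff_limsup mtau bf; split => //.
  exact: bounded_mfun_integrable.
move=> A [mA tA]; have [mf [C fC]] := bf; have [ml _] := bl.
(* Indices start at 1, since the average of index 0 is 0 and need not have the integral of [f]. *)
pose u n w := (birkhoff_avg tau f w n.+1)%:E.
have mu_ n : measurable_fun A (u n).
  have [mav _] := bounded_mfun_birkhoff_avg mtau n.+1 bf.
  by apply/measurable_EFinP; exact: measurable_funTS.
have mE := measurable_birkhoff_cvg_set mtau bf.
have PE : P (birkhoff_cvg_set tau f) = 1%E.
  have := capacity_birkhoff_cvg_set mtau capacity_probability convex_probability
    continuous_at_setT_probability strongly_invariant_probability bf.
  by move=> h; rewrite -[LHS]fineK ?fin// -/(nuP _) h.
have PE0 : P (~` birkhoff_cvg_set tau f) = 0%E.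
  by rewrite probability_setC// PE subee.
have [] := @dominated_convergence _ T R P A mA u (EFin \o birkhoff_limsup tau f) (cst C%:E).
- exact: mu_.
- by apply/measurable_EFinP; exact: measurable_funTS.
- exists (~` birkhoff_cvg_set tau f); split; first exact: measurableC.
    exact: PE0.
  move=> w /= h Ew; apply: h => _; apply: cvg_EFin; first exact: nearW.
  have := birkhoff_cvg_setP bf Ew; rewrite -cvg_shiftS; exact.
- exact: (bounded_mfun_integrable (f := cst C) mA (bounded_mfun_cst _ _)).
- by apply: aeW => w n _; rewrite lee_fin birkhoff_avg_bound.
move=> _ _ ucvg; have uE n : (\int[P]_(w in A) u n w = \int[P]_(w in A) (f w)%:E)%E.
  have bav := bounded_mfun_birkhoff_avg mtau n.+1 bf.
  rewrite -[LHS]fineK; last exact: integrable_fin_num (bounded_mfun_integrable mA bav).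
  rewrite -[RHS]fineK; last exact: integrable_fin_num (bounded_mfun_integrable mA bf).
  congr EFin; rewrite -/(Rintegral _ _ _); under eq_Rintegral do rewrite birkhoff_avgE.
  have bS : bounded_mfun (birkhoff_sum tau f n.+1).
    by apply: bounded_mfun_sum => k; exact: bounded_mfun_iter.
  rewrite RintegralZl//; last exact: bounded_mfun_integrable.
  by rewrite Rintegral_birkhoff_sum// mulKf// pnatr_eq0.
move: ucvg; under eq_fun do rewrite uE.
by move=> /(cvg_lim (@ereal_hausdorff R)) <-; rewrite lim_cst.
Qed.

End invariant_probability.

Unset Implicit Arguments.

Theorem corollary2 (R : realType) (d : measure_display) (T : measurableType d)
    (tau : T -> T) (nu : set T -> R)
    (hT : standard_borel R T)
    (htau : measurable_fun setT tau)
    (hnu : capacity nu)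
    (hconv : convex_capacity nu)
    (hcont : continuous_at_setT nu)
    (hinv : strongly_invariant tau nu)
    (f : T -> R) (hf : bounded_measurable measurable f) :
  exists fstar : T -> R,
    [/\ bounded_measurable (invariant_sets tau) fstar,
        capacity_as nu
          (fun w => birkhoff_avg tau f w n @[n --> \oo] --> fstar w),
        forall P : probability T R, invariant_probability tau P ->
          is_cond_exp P (invariant_sets tau) f fstar,
        choquet nu fstar = choquet nu f
      & ergodic tau nu ->
          nu [set w | cvgn (birkhoff_avg tau f w) /\
                choquet nu f <= limn (birkhoff_avg tau f w)
                  <= choquet (conjugate nu) f] = 1].
Proof.
have bf : bounded_mfun f.
  case: hf => [[C [_ fC]] mf]; split.
    by move=> _ B mB; rewrite setTI; exact: mf.
  by exists (C + 1) => w; apply: fC => //; rewrite ltrDl.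
have [_ [C fC]] := bf; pose fstar := birkhoff_limsup tau f.
have bl : bounded_mfun fstar by exact: bounded_mfun_birkhoff_limsup.
have [ml [D lD]] := bl.
have lt w : fstar (tau w) = fstar w by exact: birkhoff_limsup_invariant fC.
have mG (B : set R) : measurable B -> invariant_sets tau (fstar @^-1` B).
  move=> mB; split; last by apply/funext => w /=; rewrite lt.
  by rewrite -[X in measurable X]setTI; exact: ml.
have mE := measurable_birkhoff_cvg_set htau bf.
have nuE := capacity_birkhoff_cvg_set htau hnu hconv hcont hinv bf.
have Ifstar : choquet nu fstar = choquet nu f by exact: choquet_birkhoff_limsup.
exists fstar; split => //.
- split=> //; exists D; split; first exact: num_real.
  by move=> M /ltW DM w _; exact: le_trans DM.
- by exists (birkhoff_cvg_set tau f); split => // w; exact: birkhoff_cvg_setP.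
- by move=> P invP; exact: is_cond_exp_birkhoff_limsup.
move=> erg; have bNf := bounded_mfunN bf.
(* The upper bound comes from the lower bound for [- f]: [- gstar] is the liminf of the averages of
   [f]. *)
pose gstar := birkhoff_limsup tau (fun w => - f w).
have [_ [C' NfC]] := bNf.
have bg : bounded_mfun gstar by exact: bounded_mfun_birkhoff_limsup.
have gt w : gstar (tau w) = gstar w by exact: birkhoff_limsup_invariant NfC.
have h1 := ergodic_superlevel hnu hconv hcont erg bl lt.
have h2 := ergodic_superlevel hnu hconv hcont erg bg gt.
have [mg _] := bg; have [nu01 nu0 nuT nu_mono] := hnu.
set S := [set w | _].
have -> : S = birkhoff_cvg_set tau f `&` ([set w | choquet nu f <= fstar w] `&`
    [set w | fstar w <= choquet (conjugate nu) f]).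
  apply/seteqP; split => w /=.
    move=> [cw]; have Ew := cvg_birkhoff_cvg_set bf cw.
    by rewrite (cvg_lim _ (birkhoff_cvg_setP bf Ew))// => /andP[].
  move=> [Ew [l1 l2]]; have cw := birkhoff_cvg_setP bf Ew.
  by split; [exact: cvgP cw|rewrite (cvg_lim _ cw)// l1].
have mS : measurable (birkhoff_cvg_set tau f `&` ([set w | choquet nu f <= fstar w] `&`
    [set w | fstar w <= choquet (conjugate nu) f])).
  apply: measurableI => //; apply: measurableI; first exact: measurable_superlevel.
  by apply: measurable_set_le => //; exact: measurable_cst.
apply/eqP; rewrite eq_le; have /andP[_ ->] /= := nu01 _ mS.
(* Three sets of full capacity arranged as a sequence, to which [capacity_full_bigcap] applies. *)
pose F n := if n is k.+1 then
  if k is 0 then [set w | choquet nu fstar <= fstar w]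
  else [set w | choquet nu gstar <= gstar w] else birkhoff_cvg_set tau f.
have mF n : measurable (F n) by case: n => [|[|n]] //=; exact: measurable_superlevel.
have F1 n : nu (F n) = 1 by case: n => [|[|n]].
rewrite -(capacity_full_bigcap hnu hconv hcont mF F1); apply: nu_mono => //.
  exact: bigcapT_measurable.
move=> w Fw; have Ew := Fw 0%N I; have l1 := Fw 1%N I; have l2 := Fw 2%N I.
split=> //; split; first by rewrite -Ifstar.
(* On the convergence set [fstar] is at most [- gstar], hence at most minus the integral of [gstar],
   which equals that of [- f]. *)
apply: le_trans (choquetN_le_conjugate hnu bf).
have Igstar : choquet nu gstar = choquet nu (fun w => - f w).
  exact: choquet_birkhoff_limsup.
by rewrite lerNr -Igstar (le_trans l2)// -subr_le0 opprK addrC.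
Qed.
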